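(* Let $B$ be a square substochastic matrix. If $\alpha:=\widehat{\operatorname{con}}\,B$ is finite, then $$1=\Vert B^{0}\Vert_\infty=\cdots=\Vert B^{\alpha}\Vert_\infty>\Vert B^{\alpha+1}\Vert_\infty\geq\Vert B^{\alpha+2}\Vert_\infty\geq\cdots.$$ Otherwise (i.e. if $\widehat{\operatorname{con}}\,B=\infty$), $$1=\Vert B^{1}\Vert_\infty=\Vert B^{2}\Vert_\infty=\cdots.$$
   Context: A substochastic matrix is a real matrix $B=(b_{ij})$ with $b_{ij}\ge 0$ for all $i,j$ and $\sum_j b_{ij}\le 1$ for all $i$. $\Vert\cdot\Vert_\infty$ is the matrix norm induced by the vector infinity norm (maximum absolute row sum), and $B^0=I$. For a square matrix $B$ of order $n$, its digraph has vertex set $\{1,\dots,n\}$ and an edge $i\to j$ if and only if $b_{ij}\neq 0$. A walk is a nonempty finite sequence of consecutive edges $i_1\to i_2\to\cdots\to i_\ell$ ($\ell\ge 2$) in the digraph; its length $|p|$ is the number of edges $\ell-1$, $\operatorname{head}p=i_1$ is its first vertex and $\operatorname{last}p=i_\ell$ its last vertex. Let $\hat J(B)=\{i:\sum_j b_{ij}<1\}$ and let $\hat P_i(B)$ be the set of walks $p$ in the digraph of $B$ with $\operatorname{head}p=i$ and $\operatorname{last}p\in\hat J(B)$. The index of contraction of $B$ is $$\widehat{\operatorname{con}}\,B=\max\Bigl(0,\ \sup_{i\notin\hat J(B)}\ \inf_{p\in\hat P_i(B)}|p|\Bigr),$$ where $i\notin\hat J(B)$ means $i\in\{1,\dots,n\}\setminus\hat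 J(B)$, and $\inf\emptyset=\infty$, $\sup\emptyset=-\infty$. *)

(* Defs.v *)
From HB Require Import structures.
From mathcomp Require Import all_boot all_order all_algebra.
From mathcomp Require Import all_classical all_reals all_analysis.

Set Implicit Arguments.
Unset Strict Implicit.
Unset Printing Implicit Defensive.

Import Order.TTheory GRing.Theory Num.Theory.
Import numFieldNormedType.Exports.

Local Open Scope classical_set_scope.
Local Open Scope ring_scope.

Definition substochastic (R : realType) (n : nat) (B : 'M[R]_n) : Prop :=
  (forall i j, 0 <= B i j) /\ (forall i, \sum_j B i j <= 1).

(* The library norm `|x| of a column vector x is max_i `|x i 0|, so this is the
   operator norm induced by the infinity norm. *)
Definition norm_oo (R : realType) (n : nat) (B : 'M[R]_n) : R :=
  sup [set `|B *m x| | x in [set x : 'cV[R]_n | `|x| <= 1]].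

Lemma norm_ooE (R : realType) (n : nat) (B : 'M[R]_n) :
  norm_oo B = \big[Num.max/0]_i \sum_j `|B i j|.
Proof.
set M := \big[_/_]_i _.
have M0 : 0 <= M by exact: bigmax_ge_id.
have row_le i : \sum_j `|B i j| <= M.
  exact: (le_bigmax_cond _ (fun i => \sum_j `|B i j|)).
have normcP (x : 'cV[R]_n) (e : R) : 0 <= e ->
    (forall i, `|x i 0| <= e) <-> `|x| <= e.
  move=> e0; rewrite [X in _ <-> X <= _]mx_normrE; split=> [xe|xe i].
    by apply: bigmax_le => // -[i j] _ /=; rewrite (ord1 j).
  apply: le_trans xe.
  exact: (le_bigmax_cond _ (fun ij : 'I_n * 'I_1 => `|x ij.1 ij.2|)
            (j := (i, 0))).
have ubM : ubound [set `|B *m x| | x in [set x : 'cV[R]_n | `|x| <= 1]] M.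
  move=> _ [x /= /(normcP _ _ ler01) x1 <-]; apply/normcP => // i.
  apply: le_trans (row_le i); rewrite mxE; apply: le_trans (ler_norm_sum _ _ _) _.
  by apply: ler_sum => j _; rewrite normrM ler_piMr.
have ne : [set `|B *m x| | x in [set x : 'cV[R]_n | `|x| <= 1]] !=set0.
  by exists `|B *m (0 : 'cV[R]_n)|, (0 : 'cV[R]_n) => //=; rewrite normr0.
apply/eqP; rewrite eq_le; apply/andP; split; first exact: ge_sup.
apply: bigmax_le => [|i _].
  apply: le_trans (normr_ge0 (B *m (0 : 'cV[R]_n))) _; apply: ub_le_sup; first by exists M.
  by exists (0 : 'cV[R]_n) => //=; rewrite normr0.
pose x : 'cV[R]_n := \col_j Num.sg (B i j).
have x1 : `|x| <= 1.
  by apply/normcP => // j; rewrite mxE normr_sg lern1 leq_b1.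
apply: (@le_trans _ _ `|B *m x|); last first.
  by apply: ub_le_sup; [exists M | exists x].
have /normcP/(_ i) : `|B *m x| <= `|B *m x| by [].
move=> /(_ (normr_ge0 _)); apply: le_trans; rewrite mxE.
apply: le_trans (ler_norm _); apply: ler_sum => j _.
by rewrite mxE mulrC -normrEsg.
Qed.

Definition digraph (R : realType) (n : nat) (B : 'M[R]_n) : rel 'I_n :=
  [rel i j | B i j != 0].

Definition Jhat (R : realType) (n : nat) (B : 'M[R]_n) : set 'I_n :=
  [set i | \sum_j B i j < 1].

(* A walk with head i is represented by the sequence p of its remaining
   vertices: the walk is i :: p, its length is size p, its last vertex is
   last i p. *)
Definition Phat (R : realType) (n : nat) (B : 'M[R]_n) (i : 'I_n) :
    set (seq 'I_n) :=
  [set p | [/\ (0 < size p)%N, path (digraph B) i p & Jhat B (last i p)]].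

(* ereal_inf set0 = +oo and ereal_sup set0 = -oo. *)
Definition conhat (R : realType) (n : nat) (B : 'M[R]_n) : \bar R :=
  Order.max 0%E
    (ereal_sup [set ereal_inf [set (size p)%:R%:E | p in Phat B i]
               | i in ~` Jhat B]).

(* Main.v *)
Require Import Defs.
From mathcomp Require Import all_boot all_order all_algebra.
From mathcomp Require Import all_classical all_reals all_analysis.
Import Order.TTheory GRing.Theory Num.Theory.
Local Open Scope ring_scope.

(** The [i]-th row sum of [B ^+ k.+1] is the average, with weights [B i j], of
    the row sums of [B ^+ k].  By induction it is less than [1] exactly when a
    walk (possibly without edges) of length at most [k] leads from [i] to
    [Jhat B].  Hence the norm of [B ^+ m.+1] is less than [1] iff every vertex
    has such a walk of length at most [m], that is, iff [conhat B <= m]. *)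

Section Substochastic.
Context {R : realType} {n : nat} {B : 'M[R]_n}.
Hypothesis hB : substochastic B.

Lemma sum_row_exprS k i :
  \sum_j (B ^+ k.+1) i j = \sum_l B i l * \sum_j (B ^+ k) l j.
Proof.
under eq_bigr do rewrite exprS mxE.
by rewrite exchange_big; apply: eq_bigr => l _; rewrite mulr_sumr.
Qed.

Lemma sum_row_expr0 i : \sum_j (B ^+ 0) i j = 1.
Proof.
rewrite expr0 (bigD1 i) //= big1 ?addr0 ?mxE ?eqxx // => j ji.
by rewrite mxE eq_sym (negbTE ji).
Qed.

Lemma substochastic_expr_ge0 k i j : 0 <= (B ^+ k) i j.
Proof.
elim: k i => [|k IH] i; first by rewrite expr0 mxE ler0n.
by rewrite exprS mxE sumr_ge0 // => l _; rewrite mulr_ge0 // hB.1.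
Qed.

Lemma sum_row_expr_le k i : \sum_j (B ^+ k.+1) i j <= \sum_j (B ^+ k) i j.
Proof.
elim: k i => [|k IH] i; first by rewrite expr1 sum_row_expr0 hB.2.
rewrite sum_row_exprS [leRHS]sum_row_exprS; apply: ler_sum => l _.
by rewrite ler_wpM2l // hB.1.
Qed.

Lemma sum_row_expr_le1 k i : \sum_j (B ^+ k) i j <= 1.
Proof.
elim: k => [|k IH]; first by rewrite sum_row_expr0.
exact: le_trans (sum_row_expr_le k i) IH.
Qed.

(** A combination, with nonnegative weights of total at most 1, of numbers at most 1 falls below 1
    exactly when the weights miss mass or a positive weight meets a number below 1. *)
Lemma sum_row_exprS_lt1 k i :
  \sum_j (B ^+ k.+1) i j < 1 <->
  Jhat B i \/ exists2 l, digraph B i l & \sum_j (B ^+ k) l j < 1.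
Proof.
have le_row : \sum_l B i l * \sum_j (B ^+ k) l j <= \sum_l B i l.
  by apply: ler_sum => l _; rewrite ler_piMr ?hB.1 ?sum_row_expr_le1.
rewrite sum_row_exprS; split=> [lt1|[iJ|[l Bil ltl]]].
- apply: contrapT => /not_orP[/negP iJ nl]; move: lt1; apply/negP.
  rewrite -leNgt; rewrite -leNgt in iJ; apply: le_trans iJ _.
  apply: ler_sum => l _; have [-> | Bil] := eqVneq (B i l) 0; first by rewrite mul0r.
  rewrite ler_peMr ?hB.1 // leNgt; apply/negP => ltl; apply: nl.
  by exists l.
- exact: le_lt_trans le_row iJ.
- apply: lt_le_trans (hB.2 i).
  (* The term at [l] drops strictly since [B i l] is positive; no other term grows. *)
  rewrite (bigD1 l) //= [ltRHS](bigD1 l) //=; apply: ltr_leD.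
    by rewrite gtr_pMr // lt_neqAle eq_sym hB.1 andbT.
  by apply: ler_sum => j _; rewrite ler_piMr ?hB.1 ?sum_row_expr_le1.
Qed.

(** Unlike in [Phat], [p] may be empty, which covers [i] in [Jhat B]; the strict bound on [size p]
    makes both sides false at [k = 0]. *)
Lemma sum_row_expr_lt1 k i :
  \sum_j (B ^+ k) i j < 1 <->
  exists p, [/\ (size p < k)%N, path (digraph B) i p & Jhat B (last i p)].
Proof.
elim: k i => [|k IH] i.
  by rewrite sum_row_expr0 ltxx; split=> // -[p []].
rewrite sum_row_exprS_lt1; split.
- move=> [iJ|[l Bil /IH[p [sp pp pJ]]]]; first by exists [::].
  by exists (l :: p); split=> //=; apply/andP.
- move=> [[|l p] [/= sp pp pJ]]; [by left|right].
  by move/andP: pp => [Bil pp]; exists l => //; apply/IH; exists p.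
Qed.

Lemma norm_oo_expr k :
  norm_oo (B ^+ k) = \big[Num.max/0]_i \sum_j (B ^+ k) i j.
Proof.
rewrite norm_ooE; apply: eq_bigr => i _; apply: eq_bigr => j _.
by rewrite ger0_norm // substochastic_expr_ge0.
Qed.

Lemma norm_oo_exprS_le k : norm_oo (B ^+ k.+1) <= norm_oo (B ^+ k).
Proof.
by rewrite !norm_oo_expr; apply: le_bigmax2 => i _; exact: sum_row_expr_le.
Qed.

(** One full row suffices, as no row sum exceeds 1. *)
Lemma norm_oo_expr_eq1 k i : ~ \sum_j (B ^+ k) i j < 1 -> norm_oo (B ^+ k) = 1.
Proof.
move/negP; rewrite -leNgt => ge1; apply/eqP; rewrite norm_oo_expr eq_le.
rewrite bigmax_le ?ler01 //=; last by move=> j _; exact: sum_row_expr_le1.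
exact: le_trans ge1 (le_bigmax _ _ i).
Qed.

Lemma conhat_le m :
  (forall i, \sum_j (B ^+ m.+1) i j < 1) -> (conhat B <= m%:R%:E)%E.
Proof.
move=> lt1; rewrite /conhat ge_max lee_fin ler0n /=.
apply: ge_ereal_sup => _ [i iJ <-].
have /sum_row_expr_lt1[p [sp pp pJ]] := lt1 i.
apply: (@le_trans _ _ (size p)%:R%:E); last by rewrite lee_fin ler_nat.
apply: ereal_inf_lbound; exists p => //; split=> //.
(* An empty [p] would end at [i], which lies outside [Jhat B]. *)
by case: p pJ {sp pp}.
Qed.

Lemma conhat_ge m i :
  ~ \sum_j (B ^+ m.+1) i j < 1 -> (m.+1%:R%:E <= conhat B)%E.
Proof.
move=> nlt; rewrite /conhat le_max; apply/orP; right.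
apply: (@le_trans _ _ (ereal_inf [set (size p)%:R%:E | p in Phat B i]%classic)).
  (* A walk of length at most [m] would make row [i] deficient, so the infimum is at least [m.+1],
     also when [Phat B i] is empty. *)
  apply: le_ereal_inf_tmp => _ [p [_ pp pJ] <-].
  rewrite lee_fin ler_nat leqNgt; apply/negP => sp; apply: nlt.
  by apply/sum_row_expr_lt1; exists p.
apply: ereal_sup_ubound; exists i => // iJ; apply: nlt.
by apply/sum_row_expr_lt1; exists [::].
Qed.

Lemma conhat_leP m :
  reflect (forall i, \sum_j (B ^+ m.+1) i j < 1) (conhat B <= m%:R%:E)%E.
Proof.
apply: (iffP idP) => [le_m i|]; last exact: conhat_le.
apply: contrapT => /conhat_ge/le_trans/(_ le_m).
by rewrite lee_fin ler_nat ltnn.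
Qed.

Lemma norm_oo_exprS_lt1 m : (conhat B <= m%:R%:E)%E -> norm_oo (B ^+ m.+1) < 1.
Proof.
by move/conhat_leP => lt1; rewrite norm_oo_expr; apply: bigmax_lt.
Qed.

(** Exceeding [m] already means reaching [m.+1]; this is why a finite [conhat B] is a natural
    number. *)
Lemma conhat_gtP m :
  ~~ (conhat B <= m%:R%:E)%E ->
  (m.+1%:R%:E <= conhat B)%E /\ norm_oo (B ^+ m.+1) = 1.
Proof.
move/conhat_leP/existsNP => [i nlt].
by split; [exact: conhat_ge nlt | exact: norm_oo_expr_eq1 nlt].
Qed.

End Substochastic.

Theorem theorem2p5 (R : realType) (n : nat) (B : 'M[R]_n.+1)
    (hB : substochastic B) :
  (conhat B \is a fin_num ->
     exists alpha : nat,
       [/\ conhat B = alpha%:R%:E,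
           forall k : nat, (k <= alpha)%N -> norm_oo (B ^+ k) = 1,
           norm_oo (B ^+ alpha.+1) < norm_oo (B ^+ alpha)
         & forall k : nat, (alpha < k)%N ->
             norm_oo (B ^+ k.+1) <= norm_oo (B ^+ k)])
  /\ (conhat B = +oo%E -> forall k : nat, (0 < k)%N -> norm_oo (B ^+ k) = 1).
Proof.
have norm0 : norm_oo (B ^+ 0) = 1.
  by apply: (norm_oo_expr_eq1 hB 0 ord0); rewrite sum_row_expr0 ltxx.
split=> [fin|infty [//|k] _]; last first.
  by apply: (conhat_gtP hB k _).2; rewrite infty -ltNge ltry.
have ex_ub : exists m : nat, (conhat B <= m%:R%:E)%E.
  exists (Num.truncn (fine (conhat B))).+1.
  by rewrite -[leLHS]fineK // lee_fin ltW // truncnS_gt.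
(* The least natural upper bound of [conhat B] will turn out to be its value. *)
have [alpha le_alpha min_alpha] := ex_minnP ex_ub.
have gt_below m : (m < alpha)%N -> ~~ (conhat B <= m%:R%:E)%E.
  by move=> lt_m; apply/negP => /min_alpha; rewrite leqNgt lt_m.
have norm1 k : (k <= alpha)%N -> norm_oo (B ^+ k) = 1.
  by case: k => [|k] // /gt_below/(conhat_gtP hB)[].
exists alpha; split=> //.
- apply/eqP; rewrite eq_le le_alpha /=.
  (* For [alpha = 0] the lower bound is the 0 inside the maximum; otherwise [alpha] minus one is not
     an upper bound, and [conhat B] jumps to the next integer. *)
  case: alpha gt_below {le_alpha min_alpha norm1} => [|a] gt_below.
    by rewrite /conhat le_max lexx.
  exact: (conhat_gtP hB a (gt_below a (ltnSn a))).1.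
- by rewrite (norm1 alpha) //; exact: norm_oo_exprS_lt1.
- by move=> k _; exact: norm_oo_exprS_le.
Qed.
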